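(* Let $T$ be a tolerance of a lattice $L$ and consider the concept lattice $\mathcal{L}(L,L,{\leq}\circ T\circ{\leq})$. Then: (1) for any block $C$ of $T$, the pair $\left((C],[C)\right)$ is the unique concept $(A,B)\in\mathcal{L}(L,L,{\leq}\circ T\circ{\leq})$ with $C=A\cap B$ (that is, such a concept exists, is unique, and equals $\left((C],[C)\right)$); and (2) for any concept $(A,B)\in\mathcal{L}(L,L,{\leq}\circ T\circ{\leq})$, the set $A\cap B$ is a block of $T$ whenever $A\cap B\neq\emptyset$.
   Context: $L$ is an arbitrary lattice with order $\leq$. Binary relations are composed by: $(x,y)\in R\circ S$ iff there is $z$ with $(x,z)\in R$ and $(z,y)\in S$. A binary relation on $L$ is compatible if it is a sublattice of $L^2=L\times L$. A tolerance of $L$ is a reflexive, symmetric, compatible relation $T\subseteq L^2$. A block of $T$ is a maximal (with respect to inclusion) nonempty set $X\subseteq L$ with $X\times X\subseteq T$. For $X\subseteq L$, $(X]$ and $[X)$ denote the ideal and the filter of $L$ generated by $X$. For a formal context $(G,M,I)$ ($G,M$ sets, $I\subseteq G\times M$), put $A^I=\{m\in M : (g,m)\in I \text{ for all } g\in A\}$ for $A\subseteq G$ and ${}^I B=\{g\in G : (g,m)\in I\text{ for all } m\in B\}$ for $B\subseteq M$. A concept of $(G,M,I)$ is a pair $(A,B)$ with $A\subseteq G$, $B\subseteq M$, $A^I=B$ and ${}^IB=A$. The concept lattice $\mathcal{L}(G,M,I)$ is the set of all concepts ordered by $(A_1,B_1)\leq(A_2,B_2)$ iff $A_1\subseteq A_2$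 (iff $B_1\supseteq B_2$). *)

(* Defs.v *)
From mathcomp Require Import all_boot all_order.
From mathcomp Require Import classical_sets.

Set Implicit Arguments.
Unset Strict Implicit.
Unset Printing Implicit Defensive.

Local Open Scope classical_set_scope.

(* The notation [\;] of classical_sets takes its arguments in the opposite
   order. *)
Definition rel_comp {X Y Z : Type} (R : set (X * Y)) (S : set (Y * Z)) :
    set (X * Z) :=
  [set xz | exists2 y, R (xz.1, y) & S (y, xz.2)].

Section Lattice.
Context {d : Order.disp_t} {L : latticeType d}.

Definition le_rel : set (L * L) := [set xy | (xy.1 <= xy.2)%O].

Definition sublattice (S : set L) : Prop :=
  forall x y, S x -> S y -> S (x `&` y)%O /\ S (x `|` y)%O.

Definition is_ideal (J : set L) : Prop :=
  [/\ J !=set0, forall x y, (x <= y)%O -> J y -> J x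
    & forall x y, J x -> J y -> J (x `|` y)%O].

Definition is_filter (F : set L) : Prop :=
  [/\ F !=set0, forall x y, (x <= y)%O -> F x -> F y
    & forall x y, F x -> F y -> F (x `&` y)%O].

Definition ideal_gen (X : set L) : set L := smallest is_ideal X.

Definition filter_gen (X : set L) : set L := smallest is_filter X.

End Lattice.

Section Tolerance.
Context {d : Order.disp_t} {L : latticeType d}.

(* [L *p L] is [L * L] with the componentwise order and operations. *)
Definition compatible (R : set (L * L)) : Prop :=
  sublattice (R : set (L *p L)).

Definition tolerance (T : set (L * L)) : Prop :=
  [/\ forall x, T (x, x), forall x y, T (x, y) -> T (y, x) & compatible T].

Definition block (T : set (L * L)) (C : set L) : Prop :=
  [/\ C !=set0, C `*` C `<=` T
    & forall X : set L, X !=set0 -> X `*` X `<=` T -> C `<=` X -> X = C].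

End Tolerance.

Section FormalContext.
Context {G M : Type}.

Definition intent (I : set (G * M)) (A : set G) : set M :=
  [set m | forall g, A g -> I (g, m)].

Definition extent (I : set (G * M)) (B : set M) : set G :=
  [set g | forall m, B m -> I (g, m)].

Definition concept (I : set (G * M)) (AB : set G * set M) : Prop :=
  intent I AB.1 = AB.2 /\ extent I AB.2 = AB.1.

(* Only the carrier of the concept lattice is given; its order is inclusion of
   first components. *)
Definition concept_lattice (I : set (G * M)) : set (set G * set M) :=
  [set AB | concept I AB].

End FormalContext.

(* Main.v *)
Require Import Defs.
From mathcomp Require Import all_boot all_order.
From mathcomp Require Import classical_sets.

(** Write [I] for [<= o T o <=].  Then [T] is the symmetric part of [I], and the
    sets [{x | I (x, y)}] and [{y | I (x, y)}] are ideals and filters, so the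
    components of a concept are closed like ideals and filters.  Consequently, if
    [c] lies in a block [C] and [I (c', y)] for all [c'] in [C], then [y `&` c] is
    [T]-related to all of [C], hence lies in [C] by maximality, and [y] lies in
    the filter generated by [C]; dually for ideals.  The same meet with an
    element of [A `&` B] gives the maximality of [A `&` B] in the second part. *)

Import Order.TTheory.
Local Open Scope classical_set_scope.

Section ToleranceContext.
Context {d : Order.disp_t} {L : latticeType d} {T : set (L * L)}.
Context (hT : tolerance T).

Let I : set (L * L) := rel_comp (rel_comp le_rel T) le_rel.

Lemma tolerance_meet {a b a' b' : L} :
  T (a, b) -> T (a', b') -> T ((a `&` a')%O, (b `&` b')%O).
Proof. by case: hT => _ _ cT Tab Tab'; have [] := cT _ _ Tab Tab'. Qed.

Lemma tolerance_join {a b a' b' : L} :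
  T (a, b) -> T (a', b') -> T ((a `|` a')%O, (b `|` b')%O).
Proof. by case: hT => _ _ cT Tab Tab'; have [] := cT _ _ Tab Tab'. Qed.

Lemma le_tol_leP (x y : L) :
  I (x, y) <-> exists a b : L, [/\ (x <= a)%O, T (a, b) & (b <= y)%O].
Proof.
split=> [[b [a xa Tab] b_y]|[a [b [xa Tab b_y]]]]; first by exists a, b.
by exists b => //; exists a.
Qed.

Lemma tolerance_le_tol_le {x y : L} : T (x, y) -> I (x, y).
Proof. by move=> Txy; apply/le_tol_leP; exists x, y. Qed.

Lemma le_tol_le_refl (x : L) : I (x, x).
Proof. by apply: tolerance_le_tol_le; case: hT. Qed.

Lemma le_le_tol_le {x' x y : L} : (x' <= x)%O -> I (x, y) -> I (x', y).
Proof.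
move=> x'x /le_tol_leP[a [b [xa Tab b_y]]]; apply/le_tol_leP; exists a, b.
by split=> //; exact: le_trans x'x xa.
Qed.

Lemma le_tol_le_le {x y y' : L} : (y <= y')%O -> I (x, y) -> I (x, y').
Proof.
move=> yy' /le_tol_leP[a [b [xa Tab b_y]]]; apply/le_tol_leP; exists a, b.
by split=> //; exact: le_trans b_y yy'.
Qed.

Lemma le_tol_le_join {x x' y : L} :
  I (x, y) -> I (x', y) -> I ((x `|` x')%O, y).
Proof.
move=> /le_tol_leP[a [b [xa Tab b_y]]] /le_tol_leP[a' [b' [xa' Tab' b_y']]].
apply/le_tol_leP; exists (a `|` a')%O, (b `|` b')%O; split.
- exact: leU2.
- exact: tolerance_join.
- by rewrite leUx b_y.
Qed.

Lemma le_tol_le_meet {x y y' : L} :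
  I (x, y) -> I (x, y') -> I (x, (y `&` y')%O).
Proof.
move=> /le_tol_leP[a [b [xa Tab b_y]]] /le_tol_leP[a' [b' [xa' Tab' b_y']]].
apply/le_tol_leP; exists (a `&` a')%O, (b `&` b')%O; split.
- by rewrite lexI xa.
- exact: tolerance_meet.
- exact: leI2.
Qed.

(** For [x <= a], [T (a, b)], [b <= y], meeting with [T (x, x)] gives [T (x, x /\ b)]. Joining this
    with the reflexive pair of [x /\ y] leaves [x] on the left by absorption and lifts [x /\ b] to
    [x /\ y] on the right. *)
Lemma le_tol_le_tolerance_meet {x y : L} : I (x, y) -> T (x, (x `&` y)%O).
Proof.
have [Trefl _ _] := hT.
move=> /le_tol_leP[a [b [xa Tab b_y]]].
have := tolerance_join (tolerance_meet (Trefl x) Tab) (Trefl (x `&` y)%O).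
rewrite (meet_l xa) (join_l (leIl _ _)) (join_r _) //.
exact: leI2.
Qed.

(** Both [x] and [y] are [T]-related to [x /\ y]; joining the pairs [(x, x /\ y)] and [(x /\ y, y)]
    yields [(x, y)] by absorption. *)
Lemma le_tol_le_antisym {x y : L} : I (x, y) -> I (y, x) -> T (x, y).
Proof.
have [_ Tsym _] := hT.
move=> /le_tol_le_tolerance_meet Txy /le_tol_le_tolerance_meet /Tsym.
rewrite meetC => Tyx.
by have := tolerance_join Txy Tyx; rewrite (join_l (leIl _ _)) (join_r (leIr _ _)).
Qed.

Lemma extent_down {B : set L} {x y : L} :
  (x <= y)%O -> extent I B y -> extent I B x.
Proof. by move=> xy By b Bb; exact: le_le_tol_le xy (By b Bb). Qed.

Lemma intent_up {A : set L} {x y : L} :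
  (x <= y)%O -> intent I A x -> intent I A y.
Proof. by move=> xy Ax a Aa; exact: le_tol_le_le xy (Ax a Aa). Qed.

Lemma intent_meet {A : set L} {x y : L} :
  intent I A x -> intent I A y -> intent I A (x `&` y)%O.
Proof. by move=> Ax Ay a Aa; exact: le_tol_le_meet (Ax a Aa) (Ay a Aa). Qed.

Lemma extent_join {B : set L} {x y : L} :
  extent I B x -> extent I B y -> extent I B (x `|` y)%O.
Proof. by move=> Bx By b Bb; exact: le_tol_le_join (Bx b Bb) (By b Bb). Qed.

Lemma is_ideal_extent (B : set L) : extent I B !=set0 -> is_ideal (extent I B).
Proof. by split; [|exact: @extent_down|exact: @extent_join]. Qed.

Lemma is_filter_intent (A : set L) :
  intent I A !=set0 -> is_filter (intent I A).
Proof. by split; [|exact: @intent_up|exact: @intent_meet]. Qed.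

Lemma intent_ideal_gen (C : set L) : intent I (ideal_gen C) = intent I C.
Proof.
apply/seteqP; split=> [y Cy c Cc|y Cy x Cx].
  by apply: Cy; exact: sub_gen_smallest.
(* The extent of [{y}] is an ideal, nonempty since it contains [y] by reflexivity, and it includes
   [C]; so it includes the ideal generated by [C]. *)
have xy : extent I [set y] x.
  apply: Cx; split; last by move=> c Cc _ ->; exact: Cy.
  by apply: is_ideal_extent; exists y => _ ->; exact: le_tol_le_refl.
exact: xy.
Qed.

Lemma extent_filter_gen (C : set L) : extent I (filter_gen C) = extent I C.
Proof.
apply/seteqP; split=> [x Cx c Cc|x Cx y Cy].
  by apply: Cx; exact: sub_gen_smallest.
have xy : intent I [set x] y.
  apply: Cy; split; last by move=> c Cc _ ->; exact: Cx.
  by apply: is_filter_intent; exists x => _ ->; exact: le_tol_le_refl.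
exact: xy.
Qed.

Lemma block_tolerance {C : set L} {x y : L} :
  block T C -> C x -> C y -> T (x, y).
Proof. by move=> [_ CT _] Cx Cy; exact: CT. Qed.

Lemma block_extent_intent {C : set L} :
  block T C -> extent I C `&` intent I C = C.
Proof.
move=> bC; have [C0 _ Cmax] := bC; have [Trefl Tsym _] := hT.
apply/seteqP; split=> [x [eCx iCx]|x Cx]; last first.
  by split=> c Cc; apply: tolerance_le_tol_le; exact: (block_tolerance bC).
have Txc c : C c -> T (x, c).
  by move=> Cc; exact: le_tol_le_antisym (eCx c Cc) (iCx c Cc).
(* Since [x] is [T]-related to all of [C], adding it to [C] keeps all pairs in [T], and maximality
   applies. *)
suff <- : C `|` [set x] = C by right.
apply: Cmax; [by exists x; right| |exact: subsetUl].
move=> [u v] [/= [Cu|->] [Cv|->]].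
- exact: (block_tolerance bC).
- exact/Tsym/Txc.
- exact: Txc.
- exact: Trefl.
Qed.

Lemma intent_block {C : set L} : block T C -> intent I C = filter_gen C.
Proof.
move=> bC; have [[c0 Cc0] _ _] := bC; have eiC := block_extent_intent bC.
have CeC : C `<=` extent I C by rewrite -{1}eiC; exact: subIsetl.
have CiC : C `<=` intent I C by rewrite -{1}eiC; exact: subIsetr.
apply/seteqP; split=> [y Cy F [[_ Fup _] CF]|y Cy]; last first.
  by apply: Cy; split=> //; apply: is_filter_intent; exists c0; exact: CiC.
(* The element [y /\ c0] lies in the extent because it is below [c0], and in the intent because
   intents are closed under meets; so it is in [C], below [y]. *)
apply: (Fup _ _ (leIl y c0)); apply: CF; rewrite -eiC; split.
  exact: extent_down (leIr _ _) (CeC _ Cc0).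
exact: intent_meet Cy (CiC _ Cc0).
Qed.

Lemma extent_block {C : set L} : block T C -> extent I C = ideal_gen C.
Proof.
move=> bC; have [[c0 Cc0] _ _] := bC; have eiC := block_extent_intent bC.
have CeC : C `<=` extent I C by rewrite -{1}eiC; exact: subIsetl.
have CiC : C `<=` intent I C by rewrite -{1}eiC; exact: subIsetr.
apply/seteqP; split=> [y Cy J [[_ Jdown _] CJ]|y Cy]; last first.
  by apply: Cy; split=> //; apply: is_ideal_extent; exists c0; exact: CeC.
apply: (Jdown _ _ (leUl y c0)); apply: CJ; rewrite -eiC; split.
  exact: extent_join Cy (CeC _ Cc0).
exact: intent_up (leUr _ _) (CiC _ Cc0).
Qed.

Lemma concept_block {C : set L} :
  block T C -> concept I (ideal_gen C, filter_gen C).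
Proof.
move=> bC; split=> /=.
  by rewrite intent_ideal_gen (intent_block bC).
by rewrite extent_filter_gen (extent_block bC).
Qed.

(** One inclusion holds because [A] is an ideal and [B] a filter. For the other, extents and intents
    are antitone: [A] is the extent of [B], hence included in the extent of the block, which is the
    generated ideal; likewise for [B]. *)
Lemma concept_block_unique {A B : set L} :
  block T (A `&` B) -> concept I (A, B) ->
  (ideal_gen (A `&` B), filter_gen (A `&` B)) = (A, B).
Proof.
move=> bC [/= iA eB]; have [[c [Ac Bc]] _ _] := bC.
have JA : ideal_gen (A `&` B) `<=` A.
  apply: smallest_sub; last exact: subIsetl.
  by rewrite -eB; apply: is_ideal_extent; rewrite eB; exists c.
have FB : filter_gen (A `&` B) `<=` B.
  apply: smallest_sub; last exact: subIsetr.
  by rewrite -iA; apply: is_filter_intent; rewrite iA; exists c.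
congr pair; apply/seteqP; split=> // x.
  rewrite -(extent_block bC) -{1}eB => Bx y [_ By]; exact: Bx.
rewrite -(intent_block bC) -{1}iA => Ax y [Ay _]; exact: Ax.
Qed.

Lemma block_concept {A B : set L} :
  concept I (A, B) -> A `&` B !=set0 -> block T (A `&` B).
Proof.
move=> [/= iA eB] AB0; have [c0 [Ac0 Bc0]] := AB0.
have IAB x y : A x -> B y -> I (x, y) by rewrite -{1}eB => Bx /Bx.
split=> // [[x y] [/= [Ax Bx] [Ay By]]|X _ XT ABX].
  exact: le_tol_le_antisym (IAB _ _ Ax By) (IAB _ _ Ay Bx).
apply/seteqP; split=> // x Xx.
have IX y z : X y -> X z -> I (y, z).
  by move=> Xy Xz; apply: tolerance_le_tol_le; exact: XT.
split.
  (* To get [I (x, b)], go down to [b /\ c0], which belongs to both [A] and [B], hence to [X], where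
     [x] is related to everything. *)
  rewrite -eB => b Bb; apply: (le_tol_le_le (leIl b c0)); apply: IX => //.
  apply: ABX; split.
    by rewrite -eB; apply: (extent_down (leIr c0 b)); rewrite eB.
  by rewrite -iA; apply: intent_meet; rewrite iA.
rewrite -iA => a Aa; apply: (le_le_tol_le (leUl a c0)); apply: IX => //.
apply: ABX; split.
  by rewrite -eB; apply: extent_join; rewrite eB.
by rewrite -iA; apply: (intent_up (leUr c0 a)); rewrite iA.
Qed.

End ToleranceContext.

Theorem proposition3p3 (d : Order.disp_t) (L : latticeType d)
    (T : set (L * L)) (hT : tolerance T) :
  let I := rel_comp (rel_comp le_rel T) le_rel in
  (forall C : set L, block T C ->
     unique (fun AB : set L * set L =>
               concept_lattice I AB /\ C = AB.1 `&` AB.2)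
            (ideal_gen C, filter_gen C)) /\
  (forall A B : set L, concept_lattice I (A, B) ->
     A `&` B !=set0 -> block T (A `&` B)).
Proof.
split=> [C bC|A B]; last exact: block_concept.
split=> [|[A B] [cAB /= CE]].
  split; first exact: concept_block.
  (* The generated ideal and filter meet exactly in [C] because they are its extent and intent. *)
  by rewrite -(extent_block hT bC) -(intent_block hT bC) block_extent_intent.
by move: bC; rewrite CE => bC; exact: (concept_block_unique hT bC cAB).
Qed.
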